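(* A commutative ring $A$ corresponds to a point of the $(Cons^o,Loc^o)$ factorisation system on $CRings^{o}$ if and only if it is a nilpotent extension of a field, i.e. there is a surjective ring map from $A$ onto a field all of whose kernel elements are nilpotent.
   Context: $CRings$ is the category of commutative unital rings. $Loc$ is the class of localisation maps $A\to A[S^{-1}]$ ($S\subset A$ a subset) and $Cons$ is the class of conservative maps, i.e. maps $u:A\to B$ such that $a\in A$ is invertible iff $u(a)$ is. $(Loc,Cons)$ is a unique factorisation system on $CRings$ (left class $Loc$, right class $Cons$), viewed as $(Cons^o,Loc^o)$ on the opposite category. A ring $A$ corresponds to a point of this system if $A\neq 0$ and every localisation $A\to B$ of finite presentation with $B\neq 0$ admits a retraction $B\to A$; equivalently, every non-zero localisation $A\to A[a^{-1}]$, $a\in A$, admits a retraction. *)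

(* Defs.v *)
From HB Require Import structures.
From mathcomp Require Import all_boot all_algebra.
From mathcomp Require Import mpoly.

Set Implicit Arguments.
Unset Strict Implicit.
Unset Printing Implicit Defensive.

Import GRing.Theory.
Local Open Scope ring_scope.

(* Commutative unital rings are comPzRingType's, so the zero ring is allowed;
   {rmorphism A -> B} preserves 1. *)

(* GRing.unit would require a chosen inverse function on the ring. *)
Definition invertible (A : comPzRingType) (a : A) : Prop :=
  exists b : A, a * b = 1.

(* B, together with u, is the localisation A[S^-1]: u is initial among the
   ring maps out of A that invert every element of S. *)
Definition is_localisation_at (A B : comPzRingType) (S : A -> Prop)
    (u : {rmorphism A -> B}) : Prop :=
  (forall s, S s -> invertible (u s)) /\
  (forall (C : comPzRingType) (f : {rmorphism A -> C}),
     (forall s, S s -> invertible (f s)) ->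
     (exists g : {rmorphism B -> C}, forall a, g (u a) = f a) /\
     (forall g1 g2 : {rmorphism B -> C},
        (forall a, g1 (u a) = f a) -> (forall a, g2 (u a) = f a) ->
        forall b, g1 b = g2 b)).

(* The class Loc. *)
Definition localisation (A B : comPzRingType) (u : {rmorphism A -> B}) : Prop :=
  exists S : A -> Prop, is_localisation_at S u.

(* B = A[x_1, ..., x_n] / (f_1, ..., f_m) as an A-algebra, with x_i sent to
   b i. *)
Definition finite_presentation (A B : comNzRingType)
    (u : {rmorphism A -> B}) : Prop :=
  exists (n : nat) (b : 'I_n -> B) (m : nat) (f : 'I_m -> {mpoly A[n]}),
    (forall y : B, exists p : {mpoly A[n]}, mmap u b p = y) /\
    (forall p : {mpoly A[n]},
       mmap u b p = 0 <->
       exists c : 'I_m -> {mpoly A[n]}, p = \sum_(j < m) c j * f j).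

Definition has_retraction (A B : comPzRingType) (u : {rmorphism A -> B}) : Prop :=
  exists r : {rmorphism B -> A}, forall a, r (u a) = a.

(* The ring A itself, as a comNzRingType; polynomials are only available over
   nonzero rings. *)
Definition nonzero_ring (A : comPzRingType) (A1 : (1 : A) != 0) : Type := A.

HB.instance Definition _ (A : comPzRingType) (A1 : (1 : A) != 0) :=
  GRing.ComPzRing.on (nonzero_ring A1).
HB.instance Definition _ (A : comPzRingType) (A1 : (1 : A) != 0) :=
  GRing.PzSemiRing_isNonZero.Build (nonzero_ring A1) A1.

(* B ranges over comNzRingType, i.e. over the rings B <> 0. *)
Definition corresponds_to_point (A : comPzRingType) : Prop :=
  exists A1 : (1 : A) != 0,
    forall (B : comNzRingType) (u : {rmorphism nonzero_ring A1 -> B}),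
      localisation u -> finite_presentation u -> has_retraction u.

Definition nilpotent_extension_of_field (A : comPzRingType) : Prop :=
  exists (K : fieldType) (f : {rmorphism A -> K}),
    (forall y : K, exists x : A, f x = y) /\
    (forall x : A, f x = 0 -> exists n : nat, x ^+ n = 0).

(* Main.v *)
Require Import Defs.
From HB Require Import structures.
From mathcomp Require Import all_boot all_algebra.
From mathcomp Require Import mpoly boolp.

Set Implicit Arguments.
Unset Strict Implicit.
Unset Printing Implicit Defensive.

(** Both conditions on a nonzero ring A say that every element of A is either
    nilpotent or invertible.

    If A is a point and a is not nilpotent, then A[1/a] is a nonzero finitely
    presented localisation of A ([localisation_away]); a retraction
    A[1/a] -> A sends the invertible image of a back to a, so a is invertible
    ([nonnilpotent_invertible_of_point]). The quotient of A by its nilradical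
    is then a nonzero ring whose nonzero elements are invertible, which makes A
    a nilpotent extension of a field
    ([nilpotent_extension_of_nonnilpotent_invertible]).

    Conversely, in a nilpotent extension A of a field K, an element that is not
    nilpotent has a nonzero image in K, and any lift of the inverse of this
    image inverts it up to a nilpotent, hence up to a unit
    ([nonnilpotent_invertible_of_extension]). If u : A -> A[S^-1] has a nonzero
    target, no element of S is nilpotent, so all of S is already invertible in
    A and the universal property applied to the identity of A yields a
    retraction of u ([retraction_of_localisation]).

    The concrete work is the construction of A[1/a] as A[X]/(aX - 1): it is
    nonzero because an inverse of aX - 1 would be - (1 + aX + a^2 X^2 + ...),
    which is a polynomial only when a is nilpotent
    ([nilpotent_of_inverse_poly]). *)

Import GRing.Theory.
Local Open Scope ring_scope.

Definition nilpotent (A : comPzRingType) (a : A) : Prop :=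
  exists n : nat, a ^+ n = 0.

Lemma nilpotent0 (A : comPzRingType) : nilpotent (0 : A).
Proof. by exists 1%N; rewrite expr1. Qed.

Lemma nilpotentM (A : comPzRingType) (a x : A) : nilpotent x -> nilpotent (a * x).
Proof. by case=> n xn0; exists n; rewrite exprMn xn0 mulr0. Qed.

Lemma nilpotentD (A : comPzRingType) (x y : A) :
  nilpotent x -> nilpotent y -> nilpotent (x + y).
Proof.
case=> n xn0 [m ym0]; exists (n + m)%N; rewrite exprDn big1 // => i _.
have [le_im|/ltnW le_mi] := leqP i m.
  by rewrite -addnBA // exprD xn0 !mul0r mul0rn.
by rewrite -[X in y ^+ X](subnKC le_mi) exprD ym0 mul0r mulr0 mul0rn.
Qed.

Lemma trivial_of_invertible_nilpotent (B : comPzRingType) (b : B) n :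
  invertible b -> b ^+ n = 0 -> 1 = 0 :> B.
Proof.
by case=> c bc1 bn0; rewrite -(expr1n B n) -bc1 exprMn bn0 mul0r.
Qed.

Lemma invertible_rmorph (A B : comPzRingType) (u : {rmorphism A -> B}) (a : A) :
  invertible a -> invertible (u a).
Proof. by case=> b ab1; exists (u b); rewrite -rmorphM ab1 rmorph1. Qed.

Lemma inverse_unique (A : comPzRingType) (a b c : A) :
  a * b = 1 -> a * c = 1 -> b = c.
Proof. by move=> ab1 ac1; rewrite -[b]mulr1 -ac1 mulrA [b * a]mulrC ab1 mul1r. Qed.

(** If b is the inverse of a, then a + x = a (1 + b x), and 1 + b x is inverted
    by the geometric series in - b x, which is a finite sum. *)
Lemma invertible_add_nilpotent (A : comPzRingType) (a x : A) :
  invertible a -> nilpotent x -> invertible (a + x).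
Proof.
case=> b ab1 [n xn0].
have [c c1] : exists c, (1 + b * x) * c = 1.
  exists (\sum_(i < n) (- (b * x)) ^+ i).
  have := subrX1 (- (b * x)) n; rewrite exprNn exprMn xn0 !mulr0 sub0r.
  by rewrite -opprD mulNr => /oppr_inj; rewrite [b * x + 1]addrC => <-.
exists (b * c); rewrite mulrA mulrDl ab1.
by rewrite [x * b]mulrC c1.
Qed.

(** Excluded middle makes membership in I decidable, which gives the boolean
    ideal that the quotient construction takes. *)
Lemma quotient_ring (R : comNzRingType) (I : R -> Prop) :
  I 0 -> ~ I 1 -> (forall a x y, I x -> I y -> I (a * x + y)) ->
  exists (B : comNzRingType) (pi : {rmorphism R -> B}),
    (forall y, exists x, pi x = y) /\ (forall x, pi x = 0 <-> I x).
Proof.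
move=> I0 I1 IMD; pose S : R -> bool := fun x => `[< I x >].
have SP x : reflect (I x) (x \in S) by exact: asboolP.
have closedS : idealr_closed S.
  split=> [||a x y]; [exact/SP | exact/SP |].
  by move=> /SP Ix /SP Iy; apply/SP/IMD.
pose J : idealr R := HB.pack S (isIdealr.Build R S closedS).
exists {ideal_quot J}, (\pi_{ideal_quot J}%qT : {rmorphism R -> {ideal_quot J}}).
split=> [y|x]; first by exists (repr y); rewrite /= reprK.
rewrite (rwP (SP x)) -[x \in S]/(x \in J) -{2}[x]subr0 Quotient.idealrBE.
by rewrite -(rwP eqP) rmorph0.
Qed.

(** The factorisation evaluates h at a chosen preimage; its value does not depend
    on the choice, and this makes it a ring morphism. *)
Lemma factor_through_surjection (R B C : comPzRingType)
    (pi : {rmorphism R -> B}) (h : {rmorphism R -> C}) :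
  (forall y, exists x, pi x = y) -> (forall x, pi x = 0 -> h x = 0) ->
  exists g : {rmorphism B -> C}, forall x, g (pi x) = h x.
Proof.
move=> pi_surj ker_le; pose s y : R := projT1 (cid (pi_surj y)).
have sK y : pi (s y) = y by rewrite /s; case: cid.
pose g y := h (s y).
have gE x : g (pi x) = h x.
  by apply/eqP; rewrite -subr_eq0 -rmorphB ker_le // rmorphB sK subrr.
have gB : zmod_morphism g.
  by move=> x y; rewrite -[x]sK -[y]sK -rmorphB !gE rmorphB.
have gM : monoid_morphism g.
  split=> [|x y]; first by rewrite -(rmorph1 pi) gE rmorph1.
  by rewrite -[x]sK -[y]sK -rmorphM !gE rmorphM.
pose G : {rmorphism B -> C} := HB.pack g
  (GRing.isZmodMorphism.Build B C g gB) (GRing.isMonoidMorphism.Build B C g gM).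
by exists G.
Qed.

Lemma zero_ring_morphism (R C : comPzRingType) :
  1 = 0 :> C -> exists g : {rmorphism R -> C}, forall x, g x = 0.
Proof.
move=> C10; pose g (x : R) : C := 0.
have gB : zmod_morphism g by move=> x y; rewrite /g subr0.
have gM : monoid_morphism g by split=> [|x y]; rewrite /g ?mul0r ?C10.
pose G : {rmorphism R -> C} := HB.pack g
  (GRing.isZmodMorphism.Build R C g gB) (GRing.isMonoidMorphism.Build R C g gM).
by exists G.
Qed.

(** The universal property of the polynomial ring must also hold for maps to the
    zero ring, since the target of a map that inverts a given element may be
    zero. That case is treated apart because [mmap] evaluates in nonzero rings. *)
Lemma mpoly_evaluation n (R : comNzRingType) (C : comPzRingType)
    (f : {rmorphism R -> C}) (c : 'I_n -> C) :
  exists e : {rmorphism {mpoly R[n]} -> C},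
    (forall a, e a%:MP = f a) /\ (forall i, e 'X_i = c i).
Proof.
have [C10|C1] := eqVneq (1 : C) 0.
  have C0 (x y : C) : x = y by rewrite -[x]mul1r -[y]mul1r C10 !mul0r.
  by have [g _] := zero_ring_morphism {mpoly R[n]} C10; exists g.
pose e := mmap (f : {rmorphism R -> nonzero_ring C1}) c.
exists (e : {rmorphism {mpoly R[n]} -> nonzero_ring C1}).
by split=> [a|i]; rewrite /e /= ?mmapC // mmapX mmap1U.
Qed.

(** Comparing coefficients forces the inverse q to be the power series
    - (1 + a X + a^2 X^2 + ...); as q is a polynomial, some power of a is 0. *)
Lemma nilpotent_of_inverse_poly (R : comNzRingType) (a : R) (q : {poly R}) :
  q * (a%:P * 'X - 1) = 1 -> nilpotent a.
Proof.
move=> q1.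
have qE i : q`_i = - a ^+ i.
  elim: i => [|i IHi].
    have := congr1 (coefp 0) q1; rewrite /= mulrBr mulr1 mulrA.
    rewrite coefB coefMX coef1 sub0r => /(canRL (@opprK _)) ->.
    by rewrite expr0.
  have := congr1 (coefp i.+1) q1; rewrite /= mulrBr mulr1 mulrA.
  rewrite coefB coefMX coefMC coef1 /= IHi => /subr0_eq <-.
  by rewrite mulNr -exprSr.
exists (size q); apply: oppr_inj.
by rewrite -qE oppr0 nth_default.
Qed.

(** A[1/a] = A[X]/(aX - 1). Taking the quotient of the polynomial ring in one
    variable, rather than constructing fractions, makes the finite presentation
    part of the construction. In the universal property, X has to go to the
    inverse of the image of a, which gives both existence and uniqueness. *)
Lemma localisation_away (R : comNzRingType) (a : R) :
  ~ nilpotent a ->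
  exists (B : comNzRingType) (u : {rmorphism R -> B}),
    [/\ localisation u, finite_presentation u & invertible (u a)].
Proof.
move=> a_nnil; pose f : {mpoly R[1]} := a%:MP * 'X_ord0 - 1.
have proper q : q * f <> 1.
  (* The coefficients of q are compared in the univariate polynomial ring. *)
  have [e [eC eX]] := mpoly_evaluation (polyC : {rmorphism R -> {poly R}})
    (fun _ : 'I_1 => 'X).
  move=> /(congr1 e); rewrite rmorphM rmorphB rmorphM rmorph1 eC eX.
  by move/nilpotent_of_inverse_poly.
have [||p x y [q ->] [r ->]|B [pi [pi_surj pi_ker]]] :=
    @quotient_ring _ (fun p => exists q, p = q * f).
- by exists 0; rewrite mul0r.
- by case=> q /esym /proper.
- by exists (p * q + r); rewrite mulrDl mulrA.
pose u : {rmorphism R -> B} := pi \o @mpolyC 1 R.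
have uxE : u a * pi 'X_ord0 = 1.
  have fK : pi f = 0 by apply/pi_ker; exists 1; rewrite mul1r.
  by rewrite /u /= -rmorphM -(rmorph1 pi); apply/eqP; rewrite -subr_eq0 -rmorphB fK.
have piE (p : {mpoly R[1]}) : mmap u (fun i => pi 'X_i) p = pi p.
  elim/mpolyind: p => [|c m p _ _ IHp]; first by rewrite !raddf0.
  rewrite !raddfD /= IHp mmapZ mmapX -mul_mpolyC rmorphM /=; congr (_ * _ + _).
  rewrite /mmap1 -mmap1_id /mmap1 rmorph_prod.
  by apply: eq_bigr => i _; rewrite rmorphXn.
exists B, u; split; last by exists (pi 'X_ord0).
- exists (eq^~ a); split=> [_ ->|C h h_inv]; first by exists (pi 'X_ord0).
  have [c hc1] := h_inv _ erefl.
  split; first have [e [eC eX]] := mpoly_evaluation h (fun _ : 'I_1 => c).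
    have [|g gE] := factor_through_surjection (h := e) pi_surj.
      move=> _ /pi_ker[q ->]; rewrite rmorphM rmorphB rmorphM eC eX hc1.
      by rewrite rmorph1 subrr mulr0.
    by exists g => b; rewrite /u /= gE.
  move=> g1 g2 g1E g2E b; have [p <-] := pi_surj b.
  have eqX i : g1 (pi 'X_i) = g2 (pi 'X_i).
    rewrite [i]ord1; apply: (@inverse_unique _ (h a)).
      by rewrite -g1E -rmorphM uxE rmorph1.
    by rewrite -g2E -rmorphM uxE rmorph1.
  (* Morphisms out of B are determined on the image of R and on the class of
     the variable, since monomials generate. *)
  elim/mpolyind: p => [|d m p _ _ IHp]; first by rewrite !raddf0.
  rewrite !rmorphD /= IHp -mul_mpolyC !rmorphM /=; congr (_ * _ + _).
    by have := g1E d; rewrite -g2E.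
  rewrite -mmap1_id /mmap1 !rmorph_prod.
  by apply: eq_bigr => i _; rewrite !rmorphXn eqX.
exists 1%N, (fun i => pi 'X_i), 1%N, (fun=> f); split=> [y|p].
  by have [p <-] := pi_surj y; exists p; rewrite piE.
rewrite piE pi_ker; split=> [[q ->]|[q ->]].
  by exists (fun=> q); rewrite big_ord1.
by exists (q ord0); rewrite big_ord1.
Qed.

Lemma field_of_invertible (B : comNzRingType) :
  (forall x : B, x != 0 -> invertible x) ->
  exists (K : fieldType) (f : {rmorphism B -> K}), bijective f.
Proof.
move=> Binv.
have /choice[inv invP] (x : B) :
    exists y : B, if x == 0 then y = 0 else y * x = 1.
  have [_|/Binv[y xy1]] := eqVneq x 0; first by exists 0.
  by exists y; rewrite mulrC.
have mulVf (x : B) : x != 0 -> inv x * x = 1.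
  by move=> /negPf x0; have := invP x; rewrite x0.
have inv0 : inv 0 = 0 by have := invP 0; rewrite eqxx.
pose K : fieldType := HB.pack (B : Type) B (GRing.ComNzRing_isField.Build B mulVf inv0).
by exists K, (idfun : {rmorphism B -> B}); exists id.
Qed.

(** A retraction carries the invertible image of a in A[1/a] back to a. *)
Lemma nonnilpotent_invertible_of_point (A : comNzRingType) :
  (forall (B : comNzRingType) (u : {rmorphism A -> B}),
      localisation u -> finite_presentation u -> has_retraction u) ->
  forall a : A, ~ nilpotent a -> invertible a.
Proof.
move=> pointA a /localisation_away[B [u [locu fpu inv_ua]]].
have [r rK] := pointA B u locu fpu.
by rewrite -[a]rK; apply: invertible_rmorph.
Qed.

(** The field is the quotient by the nilradical. *)
Lemma nilpotent_extension_of_nonnilpotent_invertible (A : comNzRingType) :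
  (forall a : A, ~ nilpotent a -> invertible a) ->
  nilpotent_extension_of_field A.
Proof.
move=> invA.
have [||a x y nx ny|B [pi [pi_surj pi_ker]]] := @quotient_ring A (@nilpotent A).
- exact: nilpotent0.
- by case=> n /eqP; rewrite expr1n oner_eq0.
- by apply: nilpotentD => //; apply: nilpotentM.
have [|K [f f_bij]] := @field_of_invertible B.
  move=> y; have [x <-] := pi_surj y => pix0.
  by apply/invertible_rmorph/invA => /pi_ker/eqP; apply/negP.
exists K, (f \o pi); split=> [y|x /= fpix0].
  have [g _ gK] := f_bij; have [x xE] := pi_surj (g y).
  by exists x; rewrite /= xE gK.
by apply/pi_ker/(bij_inj f_bij); rewrite fpix0 rmorph0.
Qed.

(** A nilpotent element of S would become both nilpotent and invertible in B. So S
    consists of units of A, the identity of A inverts S, and it factors through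
    u. *)
Lemma retraction_of_localisation (A B : comPzRingType)
    (u : {rmorphism A -> B}) :
  (forall a : A, ~ nilpotent a -> invertible a) ->
  1 <> 0 :> B -> localisation u -> has_retraction u.
Proof.
move=> invA B1 [S [Su univ]].
have [s Ss|[g gE] _] := univ A idfun; last by exists g.
apply: invA => -[n sn0]; apply: B1.
apply: (trivial_of_invertible_nilpotent (n := n) (Su s Ss)).
by rewrite -rmorphXn sn0 rmorph0.
Qed.

(** For b lifting the inverse of f a, the element a b - 1 lies in the kernel of f,
    so a b is the sum of 1 and a nilpotent. *)
Lemma nonnilpotent_invertible_of_extension (A : comPzRingType) :
  nilpotent_extension_of_field A ->
  forall a : A, ~ nilpotent a -> invertible a.
Proof.
case=> K [f [f_surj f_nil]] a a_nnil.
have fa0 : f a != 0 by apply/eqP => /f_nil.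
have [b fb] := f_surj (f a)^-1.
have [||c abc1] := @invertible_add_nilpotent A 1 (a * b - 1).
- by exists 1; rewrite mulr1.
- by apply: f_nil; rewrite rmorphB rmorphM fb divff // rmorph1 subrr.
by exists (b * c); rewrite mulrA -abc1 addrC subrK.
Qed.

Theorem proposition54 (A : comPzRingType) :
  corresponds_to_point A <-> nilpotent_extension_of_field A.
Proof.
split=> [[A1 pointA]|extA].
  apply: (@nilpotent_extension_of_nonnilpotent_invertible (nonzero_ring A1)).
  exact: nonnilpotent_invertible_of_point.
have [K [f _]] := extA.
have A1 : (1 : A) != 0.
  apply/eqP => /(congr1 f)/eqP; rewrite rmorph1 rmorph0; exact/negP/oner_neq0.
exists A1 => B u loc_u _; apply: retraction_of_localisation loc_u => [|/eqP].
  exact: nonnilpotent_invertible_of_extension extA.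
exact/negP/oner_neq0.
Qed.
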